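(* Let $\gamma_2:G_2\times I'_2\to I'_2$ be the action of $G_2$ on $I'_2$ given, for $g_1\in G_2$ with parameters $(q_1,r_1,t_1,x_1,s_1)$ and $f\in I'_2$, by $$(\gamma_2(g_1)\cdot f)(t,x)=q_1 f\left(\frac{t-t_1}{e^{r_1}q_1^2},\frac{x-x_1}{q_1}\right)+s_1-r_1(x-x_1).$$ Then $\gamma_2$ globalizes the local actions of the one-parameter groups generated by the basis elements $X_1,X_2,X_3,X_4,X_5$ of $\mathfrak{g}_2$ (with $X_i$ corresponding to $\xi_i\in\mathrm{Lie}(G_2)$, $1\le i\le5$).
   Context: $\mathfrak{g}_2$ is the Lie algebra of vector fields on $\mathbb{R}^3$ (coordinates $t,x,v$) spanned by $$X_1=\frac{\partial}{\partial t},\quad X_2=\frac{\partial}{\partial x},\quad X_3=\frac{\partial}{\partial v},\quad X_4=2t\frac{\partial}{\partial t}+x\frac{\partial}{\partial x}+v\frac{\partial}{\partial v},\quad X_5=t\frac{\partial}{\partial t}-x\frac{\partial}{\partial v};$$ it is the Lie point symmetry algebra of $v_t=e^{v_x}v_{xx}$. $G_2$ is the solvable Lie group of matrices $$\begin{pmatrix}e^r q^2 & 0 & 0 & t \\ 0 & q & 0 & x \\ 0 & -r q& q& s \\ 0& 0 & 0 & 1\end{pmatrix},\qquad q,r,s,t,x\in\mathbb{R},\ q>0;$$ such a matrix is said to have parameters $(q,r,t,x,s)$. $P_2\subset G_2$ is the subgroup of elements with $t=x=0$, and $\chi_2$ is the character of $P_2$ sending the element with parameters $(q,r,0,0,s)$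 to $q$. $n_{t,x}$ is the element with parameters $(1,0,t,x,0)$. $I_2$ is the space of smooth real-valued $\varphi$ on $G_2$ with $\varphi(gp)=\chi_2(p)^{-1}\varphi(g)$ for all $g\in G_2,p\in P_2$, and $I'_2$ is the space of all $f\in C^\infty(\mathbb{R}^2)$ of the form $f(t,x)=\varphi(n_{t,x})$ with $\varphi\in I_2$ (in fact $I'_2=C^\infty(\mathbb{R}^2)$). With $E_{ij}$ the $4\times4$ matrix units, $\xi_1=E_{14}$, $\xi_2=E_{24}$, $\xi_3=E_{34}$, $\xi_4=\mathrm{diag}(2,1,1,0)$, $\xi_5=E_{11}-E_{32}$ in $\mathrm{Lie}(G_2)$. Local action of a vector field: if $X$ is a vector field on $\mathbb{R}^3$ with flow $\exp(\epsilon X)$ and $f$ is a smooth function on $\mathbb{R}^2$ with graph $\Gamma_f=\{(t,x,f(t,x))\}$, then $\exp(\epsilon X)\cdot f$ is the function whose graph is $\exp(\epsilon X)(\Gamma_f)$, whenever this is the graph of a function. An action $\gamma$ of a Lie group $G$ on a space of functions globalizes the local actions generated by vector fields $X_i$ (with $X_i$ corresponding to $\xi_i\in\mathrm{Lie}(G)$) if, for every $i$ and every $f$ in the space, $\gamma(\exp(\epsilon\xi_i))\cdot f=\exp(\epsilon X_i)\cdot f$ for all $\epsilon\in\mathbb{R}$ for which the right side is defined. *)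

(* Defs.v *)
From HB Require Import structures.
From mathcomp Require Import all_boot all_order all_algebra.
From mathcomp Require Import all_classical all_reals all_analysis.

Set Implicit Arguments.
Unset Strict Implicit.
Unset Printing Implicit Defensive.

Import Order.TTheory GRing.Theory Num.Theory.
Import numFieldNormedType.Exports.

Local Open Scope classical_set_scope.
Local Open Scope ring_scope.

(* For V finite-dimensional and D open this is the usual class C^k(D): all
   iterated directional derivatives up to order k exist on D and are
   continuous there, those of order < k being Frechet differentiable. *)
Fixpoint Ck (R : realType) (V : normedModType R) (D : set V) (k : nat)
    (f : V -> R) : Prop :=
  if k is k'.+1 then
    (forall x, D x -> differentiable f x) /\ forall v : V, Ck D k' ('D_v f)
  else forall x, D x -> {for x, continuous f}.

Definition smooth (R : realType) (V : normedModType R) (D : set V)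
    (f : V -> R) : Prop := forall k, Ck D k f.

Definition expmx (R : realType) (n : nat) (A : 'M[R]_n.+1) : 'M[R]_n.+1 :=
  limn (series (fun k => k`!%:R^-1 *: A ^+ k)).

Definition Lie (R : realType) (n : nat) (G : set 'M[R]_n.+1) :
  set 'M[R]_n.+1 := [set A | forall e : R, G (expmx (e *: A))].

(* A point of R^3 is ((t, x), v); the vector field a d/dt + b d/dx + c d/dv is
   the map sending a point to the triple of coefficients (a, b, c) there. *)
Definition vector_field (R : realType) := (R * R * R -> R * R * R)%type.

(* [flow X e p p'] : the (local) flow of X is defined at time e at the point p,
   and exp(e X) p = p'. *)
Definition flow (R : realType) (X : vector_field R) (e : R)
    (p p' : R * R * R) : Prop :=
  exists (a b : R) (c : R -> R * R * R),
    [/\ a < 0 < b, a < e < b,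
        (forall u, a < u < b -> is_derive u 1 c (X (c u))),
        c 0 = p & c e = p'].

Definition graph (R : realType) (f : R * R -> R) : set (R * R * R) :=
  [set p | p.2 = f p.1].

Definition flow_image (R : realType) (X : vector_field R) (e : R)
    (A : set (R * R * R)) : set (R * R * R) :=
  [set p' | exists2 p, A p & flow X e p p'].

Definition is_function_graph (R : realType) (S : set (R * R * R)) : Prop :=
  forall y v w, S (y, v) -> S (y, w) -> v = w.

Definition local_action_defined (R : realType) (X : vector_field R) (e : R)
    (f : R * R -> R) : Prop :=
  (forall p, graph f p -> exists p', flow X e p p') /\
  is_function_graph (flow_image X e (graph f)).

(* [local_action X e f h] : exp(e X) . f is defined and equal to h; equality of
   functions is equality of graphs, so it includes equality of domains. *)
Definition local_action (R : realType) (X : vector_field R) (e : R)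
    (f h : R * R -> R) : Prop :=
  local_action_defined X e f /\ graph h = flow_image X e (graph f).

Definition is_action (R : realType) (n : nat) (G : set 'M[R]_n.+1)
    (E : set (R * R -> R))
    (act : 'M[R]_n.+1 -> (R * R -> R) -> (R * R -> R)) : Prop :=
  [/\ forall g f, G g -> E f -> E (act g f),
      forall f, E f -> act 1 f = f &
      forall g h f, G g -> G h -> E f -> act (g * h) f = act g (act h f)].

Definition globalizes (R : realType) (n m : nat) (G : set 'M[R]_n.+1)
    (E : set (R * R -> R))
    (act : 'M[R]_n.+1 -> (R * R -> R) -> (R * R -> R))
    (X : 'I_m -> vector_field R) (xi : 'I_m -> 'M[R]_n.+1) : Prop :=
  [/\ is_action G E act,
      forall i, Lie G (xi i) &
      forall i f, E f -> forall e : R, local_action_defined (X i) e f ->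
        local_action (X i) e f (act (expmx (e *: xi i)) f)].

Definition X1 (R : realType) : vector_field R := fun=> (1, 0, 0).
Definition X2 (R : realType) : vector_field R := fun=> (0, 1, 0).
Definition X3 (R : realType) : vector_field R := fun=> (0, 0, 1).
Definition X4 (R : realType) : vector_field R :=
  fun p => let: (t, x, v) := p in (2 * t, x, v).
Definition X5 (R : realType) : vector_field R :=
  fun p => let: (t, x, v) := p in (t, 0, - x).

Definition g2_basis (R : realType) (i : 'I_5) : vector_field R :=
  tnth [tuple @X1 R; @X2 R; @X3 R; @X4 R; @X5 R] i.

(* Matrix indices start at 0: E_ij is [delta_mx (i - 1) (j - 1)]. *)
Definition xi1 (R : realType) : 'M[R]_4 := delta_mx 0 3.
Definition xi2 (R : realType) : 'M[R]_4 := delta_mx 1 3.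
Definition xi3 (R : realType) : 'M[R]_4 := delta_mx 2 3.
Definition xi4 (R : realType) : 'M[R]_4 :=
  diag_mx (\row_j [:: 2; 1; 1; 0]`_j).
Definition xi5 (R : realType) : 'M[R]_4 := delta_mx 0 0 - delta_mx 2 1.

Definition LieG2_basis (R : realType) (i : 'I_5) : 'M[R]_4 :=
  tnth [tuple xi1 R; xi2 R; xi3 R; xi4 R; xi5 R] i.

Definition G2_elt (R : realType) (q r t x s : R) : 'M[R]_4 :=
  \matrix_(i, j) (nth [::] [:: [:: expR r * q ^+ 2; 0; 0; t];
                               [:: 0; q; 0; x];
                               [:: 0; - r * q; q; s];
                               [:: 0; 0; 0; 1]] i)`_j.

Definition G2 (R : realType) : set 'M[R]_4 :=
  [set g | exists q r t x s : R, 0 < q /\ g = G2_elt q r t x s].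

Definition par_q (R : realType) (g : 'M[R]_4) : R := g 1 1.
Definition par_r (R : realType) (g : 'M[R]_4) : R := - g 2 1 / g 1 1.
Definition par_t (R : realType) (g : 'M[R]_4) : R := g 0 3.
Definition par_x (R : realType) (g : 'M[R]_4) : R := g 1 3.
Definition par_s (R : realType) (g : 'M[R]_4) : R := g 2 3.

Lemma par_G2_elt (R : realType) (q r t x s : R) : 0 < q ->
  [/\ par_q (G2_elt q r t x s) = q, par_r (G2_elt q r t x s) = r,
      par_t (G2_elt q r t x s) = t, par_x (G2_elt q r t x s) = x &
      par_s (G2_elt q r t x s) = s].
Proof.
move=> q0; rewrite /par_q /par_r /par_t /par_x /par_s !mxE /=.
by split=> //; rewrite !mulNr opprK mulfK// gt_eqF.
Qed.

Definition P2 (R : realType) : set 'M[R]_4 :=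
  [set g | G2 g /\ par_t g = 0 /\ par_x g = 0].

Definition chi2 (R : realType) (p : 'M[R]_4) : R := par_q p.

Definition n2 (R : realType) (t x : R) : 'M[R]_4 := G2_elt 1 0 t x 0.

(* The parameters (q, r, t, x, s) form a global chart of the Lie group G2, with
   image the open set q > 0 of R^5; smoothness on G2 is smoothness in it. A
   function on G2 is represented by one on all matrices, whose values outside
   of G2 are irrelevant. *)
Definition smooth_on_G2 (R : realType) (phi : 'M[R]_4 -> R) : Prop :=
  smooth [set p : R * R * R * R * R | 0 < p.1.1.1.1]
    (fun p => let: (q, r, t, x, s) := p in phi (G2_elt q r t x s)).

Definition I2 (R : realType) : set ('M[R]_4 -> R) :=
  [set phi | smooth_on_G2 phi /\
     forall g p, G2 g -> P2 p -> phi (g * p) = (chi2 p)^-1 * phi g].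

Definition I2' (R : realType) : set (R * R -> R) :=
  [set f | smooth setT f /\
     exists2 phi, I2 phi & forall t x, f (t, x) = phi (n2 t x)].

Definition gamma2 (R : realType) (g1 : 'M[R]_4) (f : R * R -> R) :
    R * R -> R :=
  fun y => let: (t, x) := y in
    let q1 := par_q g1 in let r1 := par_r g1 in let t1 := par_t g1 in
    let x1 := par_x g1 in let s1 := par_s g1 in
    q1 * f ((t - t1) / (expR r1 * q1 ^+ 2), (x - x1) / q1)
      + s1 - r1 * (x - x1).

(* Main.v *)
Require Import Defs.
From mathcomp Require Import all_boot all_order all_algebra.
From mathcomp Require Import all_classical all_reals all_analysis.
From mathcomp Require Import ring.

(** The group G2 acts on R^3 by affine maps: the matrix g sends (t, x, v) to the
    first three entries of g (t, x, v, 1)^T, the last entry being always 1.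
    Two observations about this action [affine_act] give the theorem.

    First, gamma2 is the action it induces on functions through their graphs:
    the graph of gamma2(g) f is the image under g of the graph of f
    ([graph_gamma2]). Since a function is determined by its graph, the laws of
    an action of G2 on functions follow from those of the action on points.

    Second, the flow of each X_i is the one-parameter group exp(e xi_i) acting
    on points ([flow_basis]). The exponentials are computed in closed form:
    each xi_i is the sum of a diagonal matrix D and a matrix N with N^2 = DN =
    ND = 0, and then exp(D + N) = exp(D) + N ([expmx_diagD]). The flows are
    computed from uniqueness for the scalar equations y' = a y and y' = k, to
    which all five fields reduce. Hence these flows are complete, and exp(e X_i)
    maps the graph of f onto the graph of gamma2(exp(e xi_i)) f.

    It remains to see that gamma2 preserves I'_2. Any smooth f on R^2 lies in
    I'_2 ([I2'_smooth]): every element of G2 with parameters (q, r, t, x, s) is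
    n_{t,x} times an element of P2 on which chi2 is q, so
    phi(g) = q^-1 f(t, x) is the required equivariant extension. Smoothness of
    phi and of gamma2(g) f is obtained from the closure of the classes C^k under
    sums, products, inverses and composition with affine maps. *)

Set Implicit Arguments.
Unset Strict Implicit.
Unset Printing Implicit Defensive.

Import Order.TTheory GRing.Theory Num.Theory.
Import numFieldNormedType.Exports.

Local Open Scope classical_set_scope.
Local Open Scope ring_scope.

(** * Functions of class C^k *)

Lemma near_eq_differentiable (R : realType) (V W : normedModType R)
    (f g : V -> W) (x : V) :
  {near x, f =1 g} -> differentiable f x -> differentiable g x.
Proof.
move=> fg /diff_locallyP[dfc /eqaddoP fo].
have gfx := nbhs_singleton fg.
have go : g \o shift x = cst (g x) + 'd f x +o_ 0 id.
  apply/eqaddoP => e e0; near=> h; rewrite !fctE /=.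
  have <- : f (h + x) = g (h + x).
    near: h; move: fg; rewrite (near_shift 0) => fg.
    by near=> h => /=; rewrite -[x in _ + x]subr0; near: h.
  by rewrite -gfx; near: h; exact: fo.
by apply/diff_locallyP; rewrite (diff_unique dfc go).
Unshelve. all: by end_near. Qed.

Section CkCalculus.
Context {R : realType} {V : normedModType R}.
Variable D : set V.
Hypothesis openD : open D.
Implicit Types (f g : V -> R) (k : nat).

(** The rules of differentiation hold only at the points of D, whereas C^k is a
    condition on a function on the whole of V; this lemma is what allows a
    derivative to be replaced by the formula for it on D. *)
Lemma Ck_ext k f g : (forall x, D x -> f x = g x) -> Ck D k f -> Ck D k g.
Proof.
elim: k f g => [|k IHk] f g fg.
  move=> fc x Dx; rewrite /prop_for /continuous_at -fg//.
  apply: cvg_trans (fc x Dx); apply: near_eq_cvg.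
  by apply: filterS (open_nbhs_nbhs (conj openD Dx)).
have near_fg x : D x -> {near x, f =1 g}.
  by move=> Dx; apply: filterS (open_nbhs_nbhs (conj openD Dx)).
move=> [fd fD]; split=> [x Dx|v].
  exact: near_eq_differentiable (near_fg x Dx) (fd x Dx).
by apply: IHk (fD v) => x Dx; exact/near_eq_derive/near_fg.
Qed.

Lemma Ck_pred k f : Ck D k.+1 f -> Ck D k f.
Proof.
elim: k f => [|k IHk] f [fd fD].
  by move=> x Dx; exact/differentiable_continuous/fd.
by split=> // v; apply: IHk.
Qed.

Lemma Ck_cst k (a : R) : Ck D k (cst a).
Proof.
elim: k a => [|k IHk] a; first by move=> x _; exact: cvg_cst.
split=> [x _|v]; first exact: differentiable_cst.
by rewrite (_ : 'D_v _ = cst 0)//; apply/funext => x; exact: derive_cst.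
Qed.

Lemma CkD k f g : Ck D k f -> Ck D k g -> Ck D k (f + g).
Proof.
elim: k f g => [|k IHk] f g.
  by move=> fc gc x Dx; apply: cvgD; [exact: fc|exact: gc].
move=> [fd fD] [gd gD]; split=> [x Dx|v].
  by apply: differentiableD; [exact: fd|exact: gd].
apply: Ck_ext (IHk _ _ (fD v) (gD v)) => x Dx.
by rewrite deriveD//; apply: diff_derivable; [exact: fd|exact: gd].
Qed.

Lemma CkM k f g : Ck D k f -> Ck D k g -> Ck D k (f * g).
Proof.
elim: k f g => [|k IHk] f g.
  by move=> fc gc x Dx; apply: cvgM; [exact: fc|exact: gc].
move=> fk gk; have [fd fD] := fk; have [gd gD] := gk; split=> [x Dx|v].
  by apply: differentiableM; [exact: fd|exact: gd].
have Dfg := CkD (IHk _ _ (Ck_pred fk) (gD v)) (IHk _ _ (Ck_pred gk) (fD v)).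
apply: Ck_ext Dfg => x Dx.
by rewrite deriveM//; apply: diff_derivable; [exact: fd|exact: gd].
Qed.

(** The derivative of 1/f is -(1/f)(1/f) Df, so the induction closes by means of
    the product rule alone. *)
Lemma CkV k f : (forall x, D x -> f x != 0) -> Ck D k f ->
  Ck D k (fun x => (f x)^-1).
Proof.
move=> f0; elim: k => [fc x Dx|k IHk fk].
  by apply: cvgV; [exact: f0|exact: fc].
have Vk := IHk (Ck_pred fk); have [fd fD] := fk; split=> [x Dx|v].
  by apply: differentiableV; [exact: fd|exact: f0].
apply: Ck_ext (CkM (CkM (Ck_cst k (-1)) (CkM Vk Vk)) (fD v)) => x Dx.
rewrite deriveE; last by apply: differentiableV; [exact: fd|exact: f0].
rewrite diffV; [|exact: fd|exact: f0].
by rewrite !fctE /= (deriveE v (fd _ Dx)) mulN1r -invfM.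
Qed.

(** An affine map A is one whose differential L is the same at every point. Then
    D_v (F o A) = (D_(L v) F) o A, which is again of the form considered. *)
Lemma Ck_comp_affine (W : normedModType R) (A L : V -> W) (F : W -> R) k :
  (forall x, is_diff x A L) -> Ck setT k F -> Ck D k (F \o A).
Proof.
move=> dA; have Ad x : differentiable A x by case: (dA x).
elim: k F => [|k IHk] F.
  move=> Fc x _; apply: continuous_comp; last by apply: Fc.
  exact: differentiable_continuous.
move=> [Fd FD]; split=> [x _|v].
  by apply: differentiable_comp => //; exact: Fd.
rewrite (_ : 'D_v _ = 'D_(L v) F \o A); first by apply: IHk; exact: FD.
apply/funext => x; rewrite /= !deriveE//; [|exact: Fd|].
  by rewrite diff_comp//; [case: (dA x) => _ /= ->|exact: Fd].
by apply: differentiable_comp => //; exact: Fd.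
Qed.

End CkCalculus.

Lemma Ck_affine (R : realType) (V : normedModType R) (D : set V)
    (A L : V -> R) k :
  (forall x, is_diff x A L) -> Ck D k A.
Proof.
move=> dA; apply: (@Ck_comp_affine _ _ D _ A L id) => //.
case: k => [|k]; first by move=> x _; exact: cvg_id.
split=> // v; rewrite (_ : 'D_v _ = cst v); first exact: Ck_cst.
by apply/funext => x; exact: derive_id.
Qed.

(** * Differentiation of curves componentwise *)

Section Components.
Context {R : realType} {V W : normedModType R}.

Lemma is_diff_fst (p : V * W) : is_diff p fst fst.
Proof.
have fc : continuous (@fst V W) by move=> x; exact: cvg_fst.
by apply: DiffDef; [exact: linear_differentiable|exact: diff_lin].
Qed.

Lemma is_diff_snd (p : V * W) : is_diff p snd snd.
Proof.
have fc : continuous (@snd V W) by move=> x; exact: cvg_snd.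
by apply: DiffDef; [exact: linear_differentiable|exact: diff_lin].
Qed.

Lemma is_derive_diff_comp (c : R -> V) (f df : V -> W) (u : R) dc :
  is_diff (c u) f df -> is_derive u 1 c dc -> is_derive u 1 (f \o c) (df dc).
Proof.
move=> [fd fv] [/derivable1_diffP cd cv].
have fcd : differentiable (f \o c) u by exact: differentiable_comp.
apply: DeriveDef; first exact/derivable1_diffP.
by rewrite deriveE// diff_comp//= fv -deriveE// cv.
Qed.

Lemma is_derive_pair (f : R -> V) (g : R -> W) (u : R) df dg :
  is_derive u 1 f df -> is_derive u 1 g dg ->
  is_derive u 1 (fun u => (f u, g u)) (df, dg).
Proof.
move=> [/derivable1_diffP fd fv] [/derivable1_diffP gd gv].
have d := differentiable_pair fd gd.
apply: DeriveDef; first exact/derivable1_diffP.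
by rewrite deriveE// diff_pair// -!deriveE// fv gv.
Qed.

End Components.

(** * Scalar equations with constant coefficients *)

Section ScalarODE.
Context {R : realType}.
Implicit Types (a b k u e l r : R) (y : R -> R).

Lemma is_derive_affine a k u : is_derive u 1 (fun u => a + k * u) k.
Proof.
have dk := is_deriveZ k (is_derive_id u 1).
apply: is_derive_eq (is_deriveD (is_derive_cst a u 1) dk) _.
by rewrite /GRing.scale /= mulr1 add0r.
Qed.

Lemma is_derive_expRM a b u :
  is_derive u 1 (fun u => expR (a * u) * b) (a * (expR (a * u) * b)).
Proof.
have da := is_deriveZ a (is_derive_id u 1).
have dexp := is_derive1_comp (is_derive_expR (a * u)) da.
apply: is_derive_eq (is_deriveM dexp (is_derive_cst b u 1)) _.
by rewrite /GRing.scale /=; ring.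
Qed.

Section Uniqueness.
Context {l r : R}.
Hypothesis lr : l < 0 < r.

Lemma is_derive_0_itv_cst y u w :
  (forall z, l < z < r -> is_derive z 1 y 0) -> l < u < r -> l < w < r ->
  y u = y w.
Proof.
move=> dy; wlog uw : u w / u <= w.
  by move=> H uI wI; case: (leP u w) => [/H|/ltW /H] ->.
move=> /andP[lu _] /andP[_ wr].
have dyi z : z \in `[u, w] -> is_derive z 1 y 0.
  rewrite in_itv/= => /andP[uz zw]; apply: dy.
  by rewrite (lt_le_trans lu)//= (le_lt_trans zw).
have dyo z : z \in `]u, w[ -> is_derive z 1 y 0.
  by move=> /subset_itv_oo_cc; exact: dyi.
have yc : {within `[u, w], continuous y}.
  by apply: derivable_within_continuous => z /dyi [].
have [c _] := MVT_segment uw dyo yc.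
by rewrite mul0r => /eqP; rewrite subr_eq0 eq_sym => /eqP.
Qed.

(** exp(-a u) y(u) has derivative zero. *)
Lemma ode_linear a y e : l < e < r ->
  (forall u, l < u < r -> is_derive u 1 y (a * y u)) ->
  y e = expR (a * e) * y 0.
Proof.
move=> eI dy; pose z := (expR \o *%R (- a)) * y.
suff ze : z e = z 0.
  have /= : expR (a * e) * z e = expR (a * e) * z 0 by rewrite ze.
  by rewrite /z !fctE /= mulr0 expR0 mul1r mulrA -expRD mulNr subrr expR0 mul1r.
apply: is_derive_0_itv_cst => // u uI.
have da := is_deriveZ (- a) (is_derive_id u 1).
have dexp := is_derive1_comp (is_derive_expR (- a * u)) da.
apply: is_derive_eq (is_deriveM dexp (dy u uI)) _.
by rewrite /= /GRing.scale /=; ring.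
Qed.

Lemma ode_cst k y e : l < e < r ->
  (forall u, l < u < r -> is_derive u 1 y k) -> y e = y 0 + k * e.
Proof.
move=> eI dy; pose z := y - k \*: id.
suff ze : z e = z 0.
  have : z e + k * e = z 0 + k * e by rewrite ze.
  by rewrite /z !fctE /= /GRing.scale /= subrK mulr0 subr0.
apply: is_derive_0_itv_cst => // u uI.
apply: is_derive_eq (is_deriveB (dy u uI) (is_deriveZ k (is_derive_id u 1))) _.
by rewrite /GRing.scale /= mulr1 subrr.
Qed.

End Uniqueness.
End ScalarODE.

(** * The matrix exponential *)

Lemma cvg_mx (R : realType) m n (T : Type) (F : set_system T)
    (u : T -> 'M[R]_(m, n)) (M : 'M[R]_(m, n)) :
  Filter F -> (forall i j, u x i j @[x --> F] --> M i j) -> u @ F --> M.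
Proof.
move=> FF uM A [P MP PA]; rewrite /= /nbhs /=.
have : \forall x \near F, forall ij, P ij.1 ij.2 (u x ij.1 ij.2).
  by apply: filter_forall => -[i j] /=; apply: uM; exact: MP.
by apply: filterS => x Px; apply: PA => i j; exact: (Px (i, j)).
Qed.

Lemma diag_mxX (R : comNzRingType) n (d : 'rV[R]_n.+1) k :
  diag_mx d ^+ k = diag_mx (map_mx (fun x => x ^+ k) d).
Proof.
elim: k => [|k IHk].
  rewrite (_ : map_mx _ _ = const_mx 1) ?diag_const_mx//.
  by apply/rowP => j; rewrite !mxE.
rewrite exprS IHk -mulmxE mul_diag_mx; apply/matrixP => i j.
by rewrite !mxE exprS; case: eqP => _; rewrite ?mulr1n// !mulr0n mulr0.
Qed.

(** All mixed products vanish, so (D + N)^k = D^k for k > 1 and N contributes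
    to the exponential series through its first order term only. *)
Lemma expmx_diagD (R : realType) n (d : 'rV[R]_n.+1) (N : 'M[R]_n.+1) :
  N * N = 0 -> diag_mx d * N = 0 -> N * diag_mx d = 0 ->
  expmx (diag_mx d + N) = diag_mx (map_mx expR d) + N.
Proof.
move=> NN DN ND.
have powE k : (diag_mx d + N) ^+ k = diag_mx d ^+ k + N *+ (k == 1)%N.
  elim: k => [|[|k] IHk]; first by rewrite !expr0 addr0.
    by rewrite !expr1.
  rewrite exprS IHk mulrDl !mulrDr !mulrnAr NN DN !mul0rn [in N * _]exprS mulrA.
  by rewrite ND mul0r !addr0 -exprS.
apply: cvg_lim => //; apply: cvg_mx => i j.
have seriesE k : (series (fun k => k`!%:R^-1 *: (diag_mx d + N) ^+ k) k) i j
    = series (exp_coeff (d 0 i)) k *+ (i == j) + N i j *+ (1 < k)%N.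
  elim: k => [|k IHk]; first by rewrite /series/= !big_geq// mxE mul0rn addr0.
  rewrite seriesSr mxE IHk seriesSr powE diag_mxX !mxE mulmxnE /exp_coeff/=.
  rewrite mulrDr mulrnDl mulrnAr (mulrC k`!%:R^-1 (d 0 i ^+ k)) addrACA.
  congr (_ + _).
  case: k {IHk} => [|[|k]];
    by rewrite ?invr1 ?mul1r ?mulr0n ?mulr0 ?addr0 ?add0r.
under eq_fun do rewrite seriesE; rewrite !mxE.
apply: cvgD.
  case: eqP => _; last by rewrite !mulr0n; exact: cvg_cst.
  by rewrite !mulr1n; exact: is_cvg_series_exp_coeff.
by apply: cvg_near_cst; exists 2%N => // k /= ->; rewrite mulr1n.
Qed.

Lemma expmx_square_zero (R : realType) n (N : 'M[R]_n.+1) :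
  N * N = 0 -> expmx N = 1 + N.
Proof.
move=> NN; have := @expmx_diagD R n 0 N NN.
rewrite linear0 add0r mul0r mulr0 => ->//.
by congr (_ + N); apply/matrixP => i j; rewrite !mxE expR0.
Qed.

Ltac mx4_entrywise := let i := fresh in let j := fresh in
  apply/matrixP => i j;
  rewrite -?mulmxE !mxE ?big_ord_recl ?big_ord0 ?mxE;
  case: i => [[|[|[|[|//]]]] ?]; case: j => [[|[|[|[|//]]]] ?];
  rewrite /= ?(mulr1n, mulr0n, mulr0, mul0r, addr0, add0r, subr0, mulr1, mul1r);
  rewrite ?(expR0, expr1n, oppr0, mulr1)//; try ring.

Section Exponentials.
Context {R : realType}.
Implicit Type e : R.

Lemma expmx_xi1 e : expmx (e *: xi1 R) = G2_elt 1 0 e 0 0.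
Proof.
rewrite expmx_square_zero; last by rewrite /xi1; mx4_entrywise.
by rewrite /xi1 /G2_elt; mx4_entrywise.
Qed.

Lemma expmx_xi2 e : expmx (e *: xi2 R) = G2_elt 1 0 0 e 0.
Proof.
rewrite expmx_square_zero; last by rewrite /xi2; mx4_entrywise.
by rewrite /xi2 /G2_elt; mx4_entrywise.
Qed.

Lemma expmx_xi3 e : expmx (e *: xi3 R) = G2_elt 1 0 0 0 e.
Proof.
rewrite expmx_square_zero; last by rewrite /xi3; mx4_entrywise.
by rewrite /xi3 /G2_elt; mx4_entrywise.
Qed.

Lemma expmx_xi4 e : expmx (e *: xi4 R) = G2_elt (expR e) 0 0 0 0.
Proof.
have -> : e *: xi4 R = diag_mx (e *: \row_j [:: 2; 1; 1; 0]`_j) + 0.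
  by rewrite addr0 linearZ.
rewrite expmx_diagD ?mulr0 ?mul0r//.
have exp2 : expR (e * 2) = expR e ^+ 2 by rewrite mulr_natr mulr2n expRD expr2.
by rewrite /G2_elt; mx4_entrywise; rewrite exp2; ring.
Qed.

Lemma expmx_xi5 e : expmx (e *: xi5 R) = G2_elt 1 e 0 0 0.
Proof.
have -> : e *: xi5 R = diag_mx (e *: delta_mx 0 0) + (- e) *: delta_mx 2 1.
  by rewrite /xi5; mx4_entrywise.
rewrite expmx_diagD; [|by mx4_entrywise..].
by rewrite /G2_elt; mx4_entrywise.
Qed.

End Exponentials.

(** * The affine action of G2 on R^3 *)

Section AffineAction.
Context {R : realType}.

Lemma G2_eltM (q1 r1 t1 x1 s1 q2 r2 t2 x2 s2 : R) :
  G2_elt q1 r1 t1 x1 s1 * G2_elt q2 r2 t2 x2 s2 =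
  G2_elt (q1 * q2) (r1 + r2) (expR r1 * q1 ^+ 2 * t2 + t1)
    (q1 * x2 + x1) (q1 * s2 - r1 * q1 * x2 + s1).
Proof. by rewrite /G2_elt expRD; mx4_entrywise. Qed.

Lemma G2_elt1 : G2_elt 1 0 0 0 0 = 1 :> 'M[R]_4.
Proof. by rewrite /G2_elt; mx4_entrywise. Qed.

Lemma G2M (g h : 'M[R]_4) : G2 g -> G2 h -> G2 (g * h).
Proof.
move=> [q1 [r1 [t1 [x1 [s1 [q10 ->]]]]]] [q2 [r2 [t2 [x2 [s2 [q20 ->]]]]]].
by rewrite G2_eltM; do 5 eexists; split; [exact: mulr_gt0 q10 q20|].
Qed.

Lemma G2_1 : G2 (1 : 'M[R]_4).
Proof. by rewrite -G2_elt1; exists 1, 0, 0, 0, 0. Qed.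

Lemma LieG2_basis_in i : Lie (@G2 R) (LieG2_basis R i).
Proof.
move=> e; case: i => [[|[|[|[|[|//]]]]] ?];
  rewrite /LieG2_basis (tnth_nth 0) /=.
- by rewrite expmx_xi1; exists 1, 0, e, 0, 0.
- by rewrite expmx_xi2; exists 1, 0, 0, e, 0.
- by rewrite expmx_xi3; exists 1, 0, 0, 0, e.
- by rewrite expmx_xi4; exists (expR e), 0, 0, 0, 0; split=> //; exact: expR_gt0.
- by rewrite expmx_xi5; exists 1, e, 0, 0, 0.
Qed.

(** For g in G2 these are the first three entries of g (t, x, v, 1)^T; the
    entries of g that vanish on G2 are left out. *)
Definition affine_act (g : 'M[R]_4) (p : R * R * R) : R * R * R :=
  let: (t, x, v) := p in
  (g 0 0 * t + g 0 3, g 1 1 * x + g 1 3, g 2 1 * x + g 2 2 * v + g 2 3).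

Lemma affine_act_elt q r t1 x1 s1 t x v :
  affine_act (G2_elt q r t1 x1 s1) (t, x, v) =
  (expR r * q ^+ 2 * t + t1, q * x + x1, - r * q * x + q * v + s1).
Proof. by rewrite /affine_act !mxE. Qed.

Lemma affine_actM g h p : G2 g -> G2 h ->
  affine_act (g * h) p = affine_act g (affine_act h p).
Proof.
move=> [q1 [r1 [t1 [x1 [s1 [_ ->]]]]]] [q2 [r2 [t2 [x2 [s2 [_ ->]]]]]].
case: p => [[t x] v]; rewrite G2_eltM !affine_act_elt expRD.
by congr (_, _, _); ring.
Qed.

Lemma affine_act1 p : affine_act 1 p = p.
Proof.
case: p => [[t x] v]; rewrite -G2_elt1 affine_act_elt expR0.
by congr (_, _, _); ring.
Qed.

Lemma graph_inj : injective (@graph R).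
Proof.
move=> f h fh; apply/funext => y.
by have : graph f (y, f y) by []; rewrite fh.
Qed.

(** This is where the formula for gamma2 comes from: (t, x, v) is on the graph
    of f if and only if its image (T, X, V) under g satisfies
    V = q f((T - t1) / (e^r q^2), (X - x1) / q) + s1 - r (X - x1), as one sees by
    solving for t and x and substituting. *)
Lemma graph_gamma2 g f : G2 g -> graph (gamma2 g f) = affine_act g @` graph f.
Proof.
move=> [q [r [t1 [x1 [s1 [q0 ->]]]]]].
have [qE rE tE xE sE] := par_G2_elt r t1 x1 s1 q0.
have q_neq0 : q != 0 by rewrite gt_eqF.
have c_neq0 : expR r * q ^+ 2 != 0.
  by rewrite mulf_neq0 ?expf_neq0// gt_eqF// expR_gt0.
rewrite /graph /gamma2 qE rE tE xE sE; apply/seteqP; split=> [[[t x] v]/= ->|].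
  exists ((t - t1) / (expR r * q ^+ 2), (x - x1) / q,
    f ((t - t1) / (expR r * q ^+ 2), (x - x1) / q)) => //.
  have cK y : expR r * q ^+ 2 * (y / (expR r * q ^+ 2)) = y.
    by rewrite mulrC divfK.
  have qK y : q * (y / q) = y by rewrite mulrC divfK.
  rewrite affine_act_elt -[_ * q * _]mulrA cK qK !subrK.
  by congr (_, _); ring.
move=> _ [[[t x] v] /= -> <-].
rewrite -/(affine_act _ (t, x, _)) affine_act_elt /=.
by rewrite !addrK [_ * t]mulrC [q * x]mulrC !mulfK//; ring.
Qed.

Lemma local_action_affine (X : vector_field R) e f g : G2 g ->
  (forall p p', flow X e p p' <-> p' = affine_act g p) ->
  local_action_defined X e f -> local_action X e f (gamma2 g f).
Proof.
move=> Gg flowX; split=> //; rewrite graph_gamma2//.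
apply/seteqP; split=> p' [p fp pp']; exists p => //; first exact/flowX.
by apply/esym/flowX.
Qed.

End AffineAction.

(** * The flows of the five vector fields *)

Section Flows.
Context {R : realType}.
Implicit Types (p : R * R * R) (e u : R) (T Y Z : R -> R).

Definition solution_at (X : vector_field R) T Y Z u :=
  [/\ is_derive u 1 T (X (T u, Y u, Z u)).1.1,
      is_derive u 1 Y (X (T u, Y u, Z u)).1.2 &
      is_derive u 1 Z (X (T u, Y u, Z u)).2].

(** Reduction to scalar equations: T, Y, Z are the coordinates of a globally
    defined candidate for the flow, given as functions of time and of the
    initial point, and the last hypothesis is local uniqueness. *)
Lemma flowP (X : vector_field R) (T Y Z : R -> R * R * R -> R) e :
  (forall p, (T 0 p, Y 0 p, Z 0 p) = p) ->
  (forall p u, solution_at X (T ^~ p) (Y ^~ p) (Z ^~ p) u) ->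
  (forall l r T' Y' Z', l < 0 < r -> l < e < r ->
     (forall u, l < u < r -> solution_at X T' Y' Z' u) ->
     let p := (T' 0, Y' 0, Z' 0) in
     [/\ T' e = T e p, Y' e = Y e p & Z' e = Z e p]) ->
  forall p p', flow X e p p' <-> p' = (T e p, Y e p, Z e p).
Proof.
move=> sol0 sol uniq p p'; split=> [[l [r [c [lr eI cD <- <-]]]]|->].
  pose T' := (fst \o fst) \o c; pose Y' := (snd \o fst) \o c.
  pose Z' := snd \o c.
  have cE u : c u = (T' u, Y' u, Z' u).
    by rewrite /T' /Y' /Z'/=; case: (c u) => -[].
  rewrite !cE; have [] := uniq l r T' Y' Z' lr eI; last by move=> -> -> ->.
  move=> u uI; rewrite /solution_at -cE; have cu := cD u uI; split.
  - exact: is_derive_diff_comp (is_diff_comp (is_diff_fst _) (is_diff_fst _)) cu.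
  - exact: is_derive_diff_comp (is_diff_comp (is_diff_fst _) (is_diff_snd _)) cu.
  - exact: is_derive_diff_comp (is_diff_snd _) cu.
exists (- (`|e| + 1)), (`|e| + 1), (fun u => (T u p, Y u p, Z u p)); split=> //.
- by rewrite oppr_lt0 andbb ltr_wpDl.
- by rewrite -ltr_norml ltrDl.
- move=> u _; have [dT dY dZ] := sol p u.
  have XE (w : R * R * R) : X w = ((X w).1.1, (X w).1.2, (X w).2).
    by case: (X w) => -[].
  by rewrite XE; exact: is_derive_pair (is_derive_pair dT dY) dZ.
Qed.

Lemma flow_constant (a b c : R) e p p' :
  flow (fun=> (a, b, c)) e p p' <->
  p' = (p.1.1 + a * e, p.1.2 + b * e, p.2 + c * e).
Proof.
apply: (flowP (T := fun u p => p.1.1 + a * u) (Y := fun u p => p.1.2 + b * u)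
  (Z := fun u p => p.2 + c * u)).
- by move=> [[? ?] ?]; rewrite !mulr0 !addr0.
- by move=> ? u; split; exact: is_derive_affine.
- by move=> l r T Y Z lr eI sol; split; apply: (ode_cst lr eI) => u /sol[].
Qed.

Lemma flow_X4 e p p' :
  flow (@X4 R) e p p' <->
  p' = (expR (2 * e) * p.1.1, expR (1 * e) * p.1.2, expR (1 * e) * p.2).
Proof.
apply: (flowP (T := fun u p => expR (2 * u) * p.1.1)
  (Y := fun u p => expR (1 * u) * p.1.2) (Z := fun u p => expR (1 * u) * p.2)).
- by move=> [[? ?] ?]; rewrite !mulr0 expR0 !mul1r.
- move=> ? u; split; first exact: is_derive_expRM.
    by apply: is_derive_eq (is_derive_expRM _ _ _) _; rewrite mul1r.
  by apply: is_derive_eq (is_derive_expRM _ _ _) _; rewrite mul1r.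
- move=> l r T Y Z lr eI sol; split; apply: (ode_linear lr eI) => u /sol[]//=.
    by rewrite mul1r.
  by rewrite mul1r.
Qed.

Lemma flow_X5 e p p' :
  flow (@X5 R) e p p' <->
  p' = (expR (1 * e) * p.1.1, p.1.2 + 0 * e, p.2 + - p.1.2 * e).
Proof.
apply: (flowP (T := fun u p => expR (1 * u) * p.1.1)
  (Y := fun u p => p.1.2 + 0 * u) (Z := fun u p => p.2 + - p.1.2 * u)).
- by move=> [[? ?] ?]; rewrite !mulr0 expR0 !mul1r !addr0.
- move=> ? u; split; [|exact: is_derive_affine|].
    by apply: is_derive_eq (is_derive_expRM _ _ _) _; rewrite mul1r.
  by apply: is_derive_eq (is_derive_affine _ _ _) _; rewrite /= mul0r addr0.
- move=> l r T Y Z lr eI sol.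
  (* The equation for the third coordinate becomes scalar once the second one
     is known to be constant along the whole solution. *)
  have Ycst u : l < u < r -> Y u = Y 0 + 0 * u.
    by move=> uI; apply: (ode_cst lr uI) => w /sol[].
  split; [|exact: Ycst|].
    by apply: (ode_linear lr eI) => u /sol[]/=; rewrite mul1r.
  apply: (ode_cst lr eI) => u uI; have [_ _ /=] := sol u uI.
  by rewrite Ycst// mul0r addr0.
Qed.

(** Integrated form of the fact that X_i is the infinitesimal generator of the
    affine action in the direction xi_i: its coefficients at (t, x, v) are the
    first three entries of xi_i (t, x, v, 1)^T. *)
Lemma flow_basis i e p p' :
  flow (@g2_basis R i) e p p' <->
  p' = affine_act (expmx (e *: LieG2_basis R i)) p.
Proof.
case: p => [[t x] v].
case: i => [[|[|[|[|[|//]]]]] ?];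
  rewrite /g2_basis /LieG2_basis !(tnth_nth 0) [nth _ _ _]/= [X in _ *: X]/=.
- rewrite expmx_xi1 affine_act_elt expR0 flow_constant.
  by split=> ->; congr (_, _, _) => /=; ring.
- rewrite expmx_xi2 affine_act_elt expR0 flow_constant.
  by split=> ->; congr (_, _, _) => /=; ring.
- rewrite expmx_xi3 affine_act_elt expR0 flow_constant.
  by split=> ->; congr (_, _, _) => /=; ring.
- rewrite expmx_xi4 affine_act_elt expR0 flow_X4 mulr_natl mulr2n expRD mul1r.
  by split=> ->; congr (_, _, _) => /=; ring.
- rewrite expmx_xi5 affine_act_elt flow_X5 mul1r.
  by split=> ->; congr (_, _, _) => /=; ring.
Qed.

End Flows.

(** * The function space *)

Section FunctionSpace.
Context {R : realType}.

#[local] Existing Instance is_diff_fst.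
#[local] Existing Instance is_diff_snd.

Lemma smooth_gamma2 (g : 'M[R]_4) (f : R * R -> R) :
  smooth setT f -> smooth setT (gamma2 g f).
Proof.
move=> fs k.
set q := par_q g; set r := par_r g; set c := expR r * q ^+ 2.
(* gamma2 g f is q (f o A) + B for the following affine A and B, written as
   combinations of coordinates so that their differentials can be inferred. *)
pose A y := ((c^-1 \*: (@fst R R - cst (par_t g))) y,
   (q^-1 \*: (@snd R R - cst (par_x g))) y).
pose B := cst (par_s g) - r \*: (@snd R R - cst (par_x g)).
have -> : gamma2 g f = cst q * (f \o A) + B.
  apply/funext => -[t x].
  rewrite /gamma2 /A /B !fctE /= /GRing.scale /= -/q -/r -/c.
  by rewrite -addrA ![_^-1 * _]mulrC.
apply: CkD; [exact: openT| |].
  apply: CkM; [exact: openT|exact: Ck_cst|].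
  by apply: Ck_comp_affine (fs k) => x.
by apply: Ck_affine => x.
Qed.

(** The extension of f is phi(g) = q^-1 f(t, x). It is equivariant because right
    multiplication by an element of P2 fixes t and x and multiplies q by the
    value of chi2. *)
Lemma I2'_smooth (f : R * R -> R) : smooth setT f -> I2' f.
Proof.
move=> fs; split=> //.
exists (fun g => (par_q g)^-1 * f (par_t g, par_x g)); last first.
  move=> t x; have [-> _ -> ->] := par_G2_elt 0 t x 0 (@ltr01 R).
  by rewrite invr1 mul1r.
split.
  move=> k; set D := [set _ | _].
  pose Q (p : R * R * R * R * R) := p.1.1.1.1.
  pose A (p : R * R * R * R * R) := (p.1.1.2, p.1.2).
  have dpr2 (U1 U2 U3 : normedModType R) (p : U1 * U2 * U3) :
      is_diff p (fst \o fst) (fst \o fst).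
    exact: is_diff_comp (is_diff_fst _) (is_diff_fst _).
  have dQ p : is_diff p Q Q.
    exact: is_diff_comp (dpr2 _ _ _ p) (dpr2 _ _ _ _).
  have dA p : is_diff p A A.
    exact: (is_diff_pair (is_diff_comp (dpr2 _ _ _ p) (is_diff_snd _))
      (is_diff_comp (is_diff_fst _) (is_diff_snd _))).
  have openD : open D.
    apply: (@open_comp _ _ Q [set y | y > 0]); last exact: open_gt.
    by move=> p _; apply: differentiable_continuous; case: (dQ p).
  apply: (@Ck_ext _ _ _ openD _ ((fun p => (Q p)^-1) * (f \o A))).
    by move=> [[[[q r] t] x] s] _; rewrite !fctE /par_q /par_t /par_x !mxE.
  apply: CkM => //; last exact: Ck_comp_affine (fs k).
  apply: CkV => //; last exact: Ck_affine.
  by move=> p /= p0; rewrite gt_eqF.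
move=> _ _ [q1 [r1 [t1 [x1 [s1 [_ ->]]]]]] [[q2 [r2 [t2 [x2 [s2 [_ ->]]]]]]].
rewrite /chi2 G2_eltM /par_q /par_t /par_x !mxE /= => -[-> ->].
by rewrite !mulr0 !add0r invfM; ring.
Qed.

End FunctionSpace.

Theorem proposition4 (R : realType) :
  globalizes (@G2 R) (@I2' R) (@gamma2 R) (@g2_basis R) (@LieG2_basis R).
Proof.
split=> [|i|i f _ e].
- split=> [g f _ [fs _]|f _|g h f Gg Gh _].
  + exact/I2'_smooth/smooth_gamma2.
  + apply: graph_inj; rewrite graph_gamma2; last exact: G2_1.
    by under eq_imagel do rewrite affine_act1; rewrite image_id.
  + apply: graph_inj; rewrite !graph_gamma2//; last exact: G2M.
    by rewrite image_comp; apply: eq_imagel => p _; rewrite affine_actM.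
- exact: LieG2_basis_in.
- exact: local_action_affine (LieG2_basis_in i e) (flow_basis i e).
Qed.
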